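(* Let $K \in \mathbb{R}^{n\times n}$ be a rate constant matrix with stationary distribution $\pi \in \Delta_n^\circ$ and let $\{S,T\}$ be a bipartition of $[n]$ with $K_{SS}$ nonsingular. Let $M := I_T + K_{TS}K_{SS}^{-2}K_{ST}$ and let $V \in \mathbb{R}^{n\times n}$ be the matrix of Type B, i.e., with blocks ordered $S,T$, $$V = \begin{pmatrix} K_{SS}^{-1} K_{ST} M^{-1} K_{TS} K_{SS}^{-1} & -K_{SS}^{-1} K_{ST} M^{-1} \\ -M^{-1} K_{TS} K_{SS}^{-1} & M^{-1} \end{pmatrix}.$$ Then $V$ is the orthogonal projection, with respect to the $\pi$-inner product $\langle a,b\rangle_\pi = a^\top \mathrm{diag}(\pi)^{-1} b$, onto the subspace $W := \{y \in \mathbb{R}^n : K_{SS}y_S + K_{ST}y_T = \mathbf{0}\}$.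
   Context: $[n] = \{1,\dotsc,n\}$. $\Delta_n^\circ = \{y \in \mathbb{R}_{>0}^n : \sum_i y_i = 1\}$. A rate constant matrix with stationary distribution $\pi \in \Delta_n^\circ$ is a matrix $K \in \mathbb{R}^{n\times n}$ such that $K_{ij} \ge 0$ for $i \ne j$, every column of $K$ sums to $0$, and $K_{ij}\pi_j = K_{ji}\pi_i$ for all $i,j$. A bipartition $\{S,T\}$ of $[n]$ is a pair of disjoint nonempty sets with $S \cup T = [n]$; $A_{IJ}$ denotes the submatrix of $A$ with rows $I$ and columns $J$, $y_I$ the subvector of $y$ indexed by $I$, $K_{SS}^{-1} = (K_{SS})^{-1}$, $K_{SS}^{-2} = (K_{SS}^{-1})^2$, and $I_T$ is the identity in $\mathbb{R}^{T\times T}$. *)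

(* Defs.v *)
From HB Require Import structures.
From mathcomp Require Import all_boot all_order all_algebra.

Set Implicit Arguments.
Unset Strict Implicit.
Unset Printing Implicit Defensive.

Import Order.TTheory GRing.Theory Num.Theory.
Local Open Scope ring_scope.

Section Defs.

Variables (R : realFieldType) (n : nat).
Implicit Types (K A : 'M[R]_n) (p y : 'cV[R]_n) (S T I J : {set 'I_n}).

Definition open_simplex p : Prop :=
  (forall i, 0 < p i 0) /\ \sum_i p i 0 = 1.

Definition rate_constant_matrix K p : Prop :=
  [/\ forall i j, i != j -> 0 <= K i j,
      forall j, \sum_i K i j = 0
    & forall i j, K i j * p j 0 = K j i * p i 0].

Definition bipartition S T : Prop :=
  [/\ S != set0, T != set0, [disjoint S & T] & S :|: T = [set: 'I_n]].

(* A subset I of 'I_n indexes rows and columns through the increasing          *)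
(* enumeration enum_val : 'I_#|I| -> 'I_n of its elements.                     *)
Definition setmx I J A : 'M[R]_(#|I|, #|J|) :=
  mxsub (@enum_val _ (mem I)) (@enum_val _ (mem J)) A.

Definition setcv I y : 'cV[R]_#|I| := rowsub (@enum_val _ (mem I)) y.

(* Row k is the unit row vector indexed by the k-th element of I, so that      *)
(* (setsel I)^T *m A *m setsel J is A put at rows I and columns J of a zero    *)
(* n x n matrix.                                                               *)
Definition setsel I : 'M[R]_(#|I|, n) := rowsub (@enum_val _ (mem I)) 1%:M.

(* The n x n matrix with the given S,T-blocks; S and T need not consist of     *)
(* consecutive indices. See set_blockmxE below.                                *)
Definition set_blockmx S T (Ass : 'M[R]_#|S|) (Ast : 'M[R]_(#|S|, #|T|))
    (Ats : 'M[R]_(#|T|, #|S|)) (Att : 'M[R]_#|T|) : 'M[R]_n :=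
  (setsel S)^T *m Ass *m setsel S + (setsel S)^T *m Ast *m setsel T
  + ((setsel T)^T *m Ats *m setsel S + (setsel T)^T *m Att *m setsel T).

Definition typeB_core K S T : 'M[R]_#|T| :=
  let invKSS := invmx (setmx S S K) in
  1%:M + setmx T S K *m (invKSS *m invKSS) *m setmx S T K.

Definition typeB K S T : 'M[R]_n :=
  let invKSS := invmx (setmx S S K) in
  let KST := setmx S T K in
  let KTS := setmx T S K in
  let invM := invmx (typeB_core K S T) in
  set_blockmx
    (invKSS *m KST *m invM *m KTS *m invKSS) (- (invKSS *m KST *m invM))
    (- (invM *m KTS *m invKSS))              invM.

Definition pi_dot p (a b : 'cV[R]_n) : R :=
  (a^T *m invmx (diag_mx p^T) *m b) 0 0.

(* V, acting on column vectors, is the idempotent with range W whose kernel is *)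
(* the orthogonal complement of W for the inner product dot.                   *)
Definition orthogonal_projection (dot : 'cV[R]_n -> 'cV[R]_n -> R)
    (V : 'M[R]_n) (W : 'cV[R]_n -> Prop) : Prop :=
  [/\ V *m V = V,
      forall y, W y <-> exists x : 'cV[R]_n, y = V *m x
    & forall x : 'cV[R]_n, V *m x = 0 <-> (forall w, W w -> dot x w = 0)].

Definition balance_subspace K S T : 'cV[R]_n -> Prop :=
  fun y => setmx S S K *m setcv S y + setmx S T K *m setcv T y = 0.

Lemma setmx_sel I J A : setmx I J A = setsel I *m A *m (setsel J)^T.
Proof.
apply/matrixP=> i j; rewrite !mxE (bigD1 (enum_val j)) //= !mxE eqxx mulr1.
rewrite (bigD1 (enum_val i)) //= !mxE eqxx mul1r !big1 ?addr0 // => k nk.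
  by rewrite !mxE eq_sym (negPf nk) mulr0.
by rewrite !mxE eq_sym (negPf nk) mul0r.
Qed.

Lemma setselK I : setsel I *m (setsel I)^T = 1%:M.
Proof.
rewrite -[setsel I]mulmx1 trmx_mul trmx1 mul1mx -setmx_sel.
by apply/matrixP=> i j; rewrite !mxE (inj_eq enum_val_inj).
Qed.

Lemma setsel_disjoint I J : [disjoint I & J] -> setsel I *m (setsel J)^T = 0.
Proof.
move=> dIJ; rewrite -[setsel I]mulmx1 -setmx_sel.
apply/matrixP=> i j; rewrite !mxE; case: eqP => // eij.
by have := disjointFr dIJ (enum_valP i); rewrite eij (enum_valP j).
Qed.

Lemma set_blockmxE S T (Ass : 'M[R]_#|S|) (Ast : 'M[R]_(#|S|, #|T|))
    (Ats : 'M[R]_(#|T|, #|S|)) (Att : 'M[R]_#|T|) :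
  [disjoint S & T] ->
  let A := set_blockmx Ass Ast Ats Att in
  [/\ setmx S S A = Ass, setmx S T A = Ast,
      setmx T S A = Ats & setmx T T A = Att].
Proof.
move=> dST A; have dTS : [disjoint T & S] by rewrite disjoint_sym.
have [ST TS] := (setsel_disjoint dST, setsel_disjoint dTS).
rewrite !setmx_sel /A /set_blockmx.
by split; rewrite !(mulmxDl, mulmxDr) !mulmxA !(setselK, ST, TS)
  ?(mul0mx, mul1mx, add0r, addr0) -?mulmxA !(setselK, ST, TS)
  ?(mulmx0, mulmx1, add0r, addr0).
Qed.

End Defs.

(* Main.v *)
Require Import Defs.
From mathcomp Require Import all_boot all_order all_algebra.

Import Order.TTheory GRing.Theory Num.Theory.
Local Open Scope ring_scope.

(** With [E = (- K_SS^-1 K_ST ; 1)] and [F = (- K_TS K_SS^-1 , 1)], the subspace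
    [W] is the range of [E], [M = F E] and [V = E M^-1 F].  Detailed balance
    says that [K diag(pi)] is symmetric, whence [diag(pi) F^T = E diag(pi_T)].
    So [M diag(pi_T) = F diag(pi) F^T] is positive definite because [F] has
    full row rank, which makes [M] invertible, and the kernel of [F] is the
    [pi]-orthogonal complement of the range of [E]. *)

Section SetSel.

Variables (R : realFieldType) (n : nat).
Implicit Types (K : 'M[R]_n) (p y : 'cV[R]_n) (S T I J : {set 'I_n}).

Lemma setcv_sel I y : setcv I y = setsel R I *m y.
Proof. by rewrite /setcv /setsel mul_rowsub_mx mul1mx. Qed.

Lemma setcv_inj S T y z : S :|: T = [set: 'I_n] ->
  setcv S y = setcv S z -> setcv T y = setcv T z -> y = z.
Proof.
move=> ST eS eT; apply/matrixP=> i j; rewrite ord1.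
have eI I : setcv I y = setcv I z -> i \in I -> y i 0 = z i 0.
  move=> e iI; move/matrixP/(_ (enum_rank_in iI i) 0): e.
  by rewrite !mxE enum_rankK_in.
by have := in_setT i; rewrite -ST inE => /orP[/(eI _ eS)|/(eI _ eT)].
Qed.

Lemma setsel_diag I p :
  setsel R I *m diag_mx p^T = diag_mx (setcv I p)^T *m setsel R I.
Proof.
rewrite mul_mx_diag mul_diag_mx; apply/matrixP=> i j; rewrite !mxE mulrC.
by case: eqP => [->|_] //; rewrite !mulr0.
Qed.

Lemma diag_setsel I p :
  diag_mx p^T *m (setsel R I)^T = (setsel R I)^T *m diag_mx (setcv I p)^T.
Proof. by apply: trmx_inj; rewrite !trmx_mul !tr_diag_mx trmxK setsel_diag. Qed.

(** The symmetry of [K diag(p)] read block by block. Taking [I = J = S] moves [K_SS] past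
    [diag(p_S)] as its transpose; taking [I = S], [J = T] trades [K_ST] for the transpose of
    [K_TS]. *)
Lemma detailed_balance_setmx K p I J : rate_constant_matrix K p ->
  setmx I J K *m diag_mx (setcv J p)^T
    = diag_mx (setcv I p)^T *m (setmx J I K)^T.
Proof.
case=> _ _ bal; apply/matrixP=> i j.
by rewrite mul_mx_diag mul_diag_mx !mxE bal mulrC.
Qed.

End SetSel.

Lemma diag_mx_unit (R : realFieldType) (m : nat) (d : 'rV[R]_m) :
  (forall i, 0 < d 0 i) -> diag_mx d \in unitmx.
Proof.
move=> d0; rewrite unitmxE det_diag unitfE.
by apply/prodf_neq0 => i _; rewrite gt_eqF.
Qed.

(** The form equals the sum of the nonnegative terms [v_i^2 d_i], so each of them vanishes. *)
Lemma diag_form_eq0 (R : realFieldType) (m : nat) (d v : 'rV[R]_m) :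
  (forall i, 0 < d 0 i) -> v *m diag_mx d *m v^T = 0 -> v = 0.
Proof.
move=> d0 /matrixP/(_ 0 0); rewrite mul_mx_diag !mxE => sum0.
have term_ge0 i : true -> 0 <= v 0 i ^+ 2 * d 0 i.
  by move=> _; rewrite mulr_ge0 ?sqr_ge0 ?ltW.
have /(psumr_eq0P term_ge0) v0 : \sum_i v 0 i ^+ 2 * d 0 i = 0.
  by rewrite -{}[RHS]sum0; apply: eq_bigr => i _; rewrite !mxE expr2 mulrAC.
apply/rowP=> i; rewrite mxE; move/eqP: (v0 i isT).
by rewrite mulf_eq0 (gt_eqF (d0 i)) orbF sqrf_eq0 => /eqP.
Qed.

Section Projection.

Variables (R : realFieldType) (n : nat) (K : 'M[R]_n) (p : 'cV[R]_n).
Variables (S T : {set 'I_n}).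
Hypotheses (hp : open_simplex p) (hK : rate_constant_matrix K p).
Hypotheses (hST : bipartition S T) (hSS : setmx S S K \in unitmx).

Let A := setmx S S K.
Let B := setmx S T K.
Let C := setmx T S K.
Let sS := setsel R S.
Let sT := setsel R T.
Let E := sT^T - sS^T *m (invmx A *m B).
Let F := sT - C *m invmx A *m sS.
Let M := typeB_core K S T.
Let Pi := diag_mx p^T.
Let PiT := diag_mx (setcv T p)^T.

Let p_gt0 i : 0 < p^T 0 i.
Proof. by rewrite mxE; case: hp. Qed.

Let PiT_unit : PiT \in unitmx.
Proof. by apply: diag_mx_unit => i; rewrite !mxE; case: hp. Qed.

Let ST0 : sS *m sT^T = 0.
Proof. by apply: setsel_disjoint; case: hST. Qed.

Let TS0 : sT *m sS^T = 0.
Proof. by apply: setsel_disjoint; rewrite disjoint_sym; case: hST. Qed.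

Let sT_E : sT *m E = 1%:M.
Proof. by rewrite mulmxBr mulmxA TS0 mul0mx subr0 setselK. Qed.

Let sS_E : sS *m E = - (invmx A *m B).
Proof. by rewrite mulmxBr mulmxA ST0 setselK mul1mx sub0r. Qed.

Let F_sT : F *m sT^T = 1%:M.
Proof. by rewrite mulmxBl -[_ *m sS *m _]mulmxA ST0 mulmx0 subr0 setselK. Qed.

Let F_E : F *m E = M.
Proof.
rewrite mulmxBl sT_E -[_ *m sS *m _]mulmxA sS_E mulmxN opprK /M /typeB_core.
by rewrite !mulmxA.
Qed.

Let typeB_factor : typeB K S T = E *m invmx M *m F.
Proof.
rewrite /typeB /set_blockmx -/A -/B -/C -/M -/sS -/sT.
rewrite !(mulmxBl, mulmxBr) !(mulmxN, mulNmx) !mulmxA opprB addrC.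
by rewrite addrACA addrC; congr (_ + _); rewrite addrC.
Qed.

Let Pi_F : Pi *m F^T = E *m PiT.
Proof.
rewrite /F /E /PiT /A /B /C linearB /= mulmxBr diag_setsel mulmxBl.
congr (_ - _); rewrite trmx_mul mulmxA diag_setsel -!mulmxA; congr (_ *m _).
(* The S-rows remain: [diag(p_S) (C A^-1)^T = A^-1 B PiT]. After multiplying by [A] on the left,
   detailed balance on [A] cancels the inverse on each side, leaving [diag(p_S) C^T = B PiT], which
   is detailed balance again. *)
apply: (can_inj (mulKmx hSS)).
rewrite [LHS]mulmxA detailed_balance_setmx // -[LHS]mulmxA -trmx_mul.
by rewrite mulmxKV // mulKVmx // detailed_balance_setmx.
Qed.

Lemma typeB_core_unit : typeB_core K S T \in unitmx.
Proof.
rewrite -row_free_unit -/M -kermx_eq0; apply/rowV0P=> u /sub_kermxP uM.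
(* For [u] in the left kernel of [M], the form is [u F Pi F^T u^T = u F E PiT u^T = u M PiT u^T =
   0]. *)
have : u *m F *m Pi *m (u *m F)^T = 0.
  by rewrite trmx_mul mulmxA -[_ *m Pi *m _]mulmxA Pi_F mulmxA -(mulmxA u) F_E
    uM !mul0mx.
move/(diag_form_eq0 _ _ _ _ p_gt0) => uF.
by rewrite -[u]mulmx1 -F_sT mulmxA uF mul0mx.
Qed.

(** Solving for [y_S = - A^-1 B y_T] shows that a point of [W] is determined by its T-part. As [sT]
    is a left inverse of [E], lying in the range of [E] becomes an equation without an
    existential. *)
Let balance_subspaceP y :
  balance_subspace K S T y <-> y = E *m (sT *m y).
Proof.
rewrite /balance_subspace !setcv_sel -/A -/B -/sS -/sT; split=> [Wy | ->].
  apply: (@setcv_inj _ _ S T); first by case: hST.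
    rewrite !setcv_sel mulmxA sS_E mulNmx -mulmxA.
    apply: (can_inj (mulKmx hSS)).
    by rewrite mulmxN mulKVmx //; apply/eqP; rewrite -addr_eq0; apply/eqP.
  by rewrite !setcv_sel mulmxA sT_E mul1mx.
rewrite ![_ *m (E *m _)]mulmxA sS_E sT_E mul1mx mulNmx mulmxN.
by rewrite -[in X in - X]mulmxA mulKVmx // addNr.
Qed.

Let F_eq0P (x : 'cV[R]_n) :
  F *m x = 0 <-> (forall w, balance_subspace K S T w -> pi_dot p x w = 0).
Proof.
have Pi_unit : Pi \in unitmx by exact: diag_mx_unit.
(* Here [Pi^-1 E PiT = F^T]. Since [PiT] is invertible, the vectors [E PiT u] exhaust [W]. *)
have dotE u : pi_dot p x (E *m (PiT *m u)) = ((F *m x)^T *m u) 0 0.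
  by rewrite /pi_dot [E *m _]mulmxA -Pi_F -/Pi -[Pi *m _ *m _]mulmxA
    -[x^T *m _ *m _]mulmxA mulKmx // trmx_mul -[in RHS]mulmxA.
split=> [Fx w /balance_subspaceP -> | orth].
  by rewrite -[sT *m w](mulKVmx PiT_unit) dotE Fx trmx0 mul0mx mxE.
apply/matrixP=> i j; rewrite ord1 [RHS]mxE.
(* Testing orthogonality against [w = E PiT e_i] reads off the i-th entry of [F x]. *)
have <- : ((F *m x)^T *m (delta_mx i 0 : 'cV_#|T|)) 0 0 = (F *m x) i 0.
  by rewrite -colE !mxE.
rewrite -dotE; apply: orth; apply/balance_subspaceP.
by rewrite (mulmxA sT) sT_E mul1mx.
Qed.

Lemma typeB_orthogonal_projection :
  orthogonal_projection (pi_dot p) (typeB K S T) (balance_subspace K S T).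
Proof.
have M_unit : M \in unitmx := typeB_core_unit.
(* [V] fixes [W] pointwise: [E M^-1 F E = E M^-1 M = E]. Idempotence and the range follow. *)
have V_E : typeB K S T *m E = E.
  by rewrite typeB_factor -mulmxA F_E mulmxKV.
split.
- by rewrite [X in _ *m X]typeB_factor !mulmxA V_E -typeB_factor.
- move=> y; split=> [/balance_subspaceP yE | [x ->]].
    by exists y; rewrite [in RHS]yE [RHS]mulmxA V_E.
  apply/balance_subspaceP; rewrite typeB_factor -!mulmxA.
  by rewrite (mulmxA sT) sT_E mul1mx.
move=> x; apply: iff_trans (F_eq0P x).
rewrite typeB_factor -!mulmxA; split=> [Vx | ->].
  (* [M sT] is a left inverse of [E M^-1], so it recovers [F x] from [V x]. *)
  have : M *m (sT *m (E *m (invmx M *m (F *m x)))) = 0.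
    by rewrite Vx !mulmx0.
  by rewrite (mulmxA sT) sT_E mul1mx mulKVmx.
by rewrite !mulmx0.
Qed.

End Projection.

(** [invmx] returns its argument on singular matrices, so the first conjunct certifies that the
    [M^-1] inside [typeB] is a true inverse. *)
Theorem mainTheorem6 (R : realFieldType) (n : nat) (K : 'M[R]_n)
    (p : 'cV[R]_n) (S T : {set 'I_n})
    (hp : open_simplex p) (hK : rate_constant_matrix K p)
    (hST : bipartition S T) (hSS : setmx S S K \in unitmx) :
  typeB_core K S T \in unitmx /\
  orthogonal_projection (pi_dot p) (typeB K S T) (balance_subspace K S T).
Proof.
split; first exact: (typeB_core_unit R n K p).
exact: typeB_orthogonal_projection.
Qed.
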